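(* Let $p$ be a prime such that $2$ is a primitive root modulo $p$. Then $S_p(2^p)=p$, where for $x\in\mathbb{N}$, $$S_p(x)=\sum_{0\le n<x,\ n\equiv 0 \ (\mathrm{mod}\ p)}(-1)^{\sigma(n)},$$ and $\sigma(n)$ denotes the number of $1$'s in the binary expansion of $n$.
   Context: For $m,x\in\mathbb{N}$, $S_m(x)=\sum_{0\le n<x,\ m\mid n}(-1)^{\sigma(n)}$, where $\sigma(n)$ is the binary digit sum (number of ones in the binary expansion) of $n$. *)

(* Defs.v *)
From mathcomp Require Import all_boot all_order all_algebra.

Set Implicit Arguments.
Unset Strict Implicit.
Unset Printing Implicit Defensive.

Local Open Scope ring_scope.

(* The i-th binary digit of n is the parity of n %/ 2 ^ i; since n < 2 ^ n,
   the digits of index at least n vanish. *)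
Definition sigma (n : nat) : nat := (\sum_(i < n) odd (n %/ 2 ^ i))%N.

Definition Ssum (m x : nat) : int :=
  \sum_(0 <= n < x | (m %| n)%N) (-1) ^+ sigma n.

(* Main.v *)
(** Let [z] be a primitive [p]-th root of unity.  Orthogonality gives
    [p S_p(2^p) = \sum_(j < p) \sum_(n < 2^p) (-1)^(sigma n) (z^j)^n], and the
    inner sum factors as [\prod_(k < p) (1 - w^(2^k))] with [w = z^j].  It
    vanishes for [j = 0].  Otherwise [2^0, ..., 2^(p-2)] run over the nonzero
    residues, so the first [p - 1] factors multiply to [p], and the last one is
    [1 - w] by Fermat.  Summing [p (1 - z^j)] over [0 < j < p] gives [p ^ 2]. *)
Require Import Defs.
From mathcomp Require Import all_boot all_order all_algebra all_field.
From mathcomp Require Import ring zify.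

Set Implicit Arguments.
Unset Strict Implicit.
Unset Printing Implicit Defensive.

Import GRing.Theory Num.Theory.

Local Open Scope ring_scope.

Lemma sigma_widen (m n : nat) :
  (n <= m)%N -> sigma n = (\sum_(i < m) odd (n %/ 2 ^ i))%N.
Proof.
move=> le_nm; rewrite /sigma -!(big_mkord xpredT (fun i => odd (n %/ 2 ^ i) : nat)).
rewrite [RHS](big_cat_nat (leq0n n) le_nm) /= [X in _ = (_ + X)%N]big1_seq ?addn0 //.
move=> i; rewrite mem_index_iota => /and3P[_ le_ni _].
by rewrite divn_small // (leq_ltn_trans le_ni) // ltn_expl.
Qed.

Lemma sigma_bit (b : bool) (n : nat) : sigma (b + n.*2) = (b + sigma n)%N.
Proof.
(* The padded lengths differ by one, so that both digit sums have the same range once the lowest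
   digit [b] is split off. *)
rewrite (@sigma_widen n.*2.+2) 1?big_ord_recl; last by case: b; lia.
rewrite (@sigma_widen n.*2.+1 n) ?divn1 ?oddD ?odd_double; last by lia.
congr (_ + _)%N; first by case: b.
apply: eq_bigr => i _; rewrite lift0 expnS divnMA.
by rewrite divn2 half_bit_double.
Qed.

Lemma big_nat_double (R : nmodType) (F : nat -> R) (m : nat) :
  \sum_(0 <= n < m.*2) F n = \sum_(0 <= n < m) (F n.*2 + F n.*2.+1).
Proof.
elim: m => [|m IHm]; first by rewrite !big_nil.
by rewrite doubleS !big_nat_recr //= IHm addrA.
Qed.

(** Induction on the number of bits: pairing [2n] with [2n + 1] pulls out the factor [1 - z] and
    leaves the same sum at [z ^+ 2]. *)
Lemma thue_morse_generating (R : comNzRingType) (k : nat) (z : R) :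
  \sum_(0 <= n < 2 ^ k) (-1) ^+ sigma n * z ^+ n =
  \prod_(i < k) (1 - z ^+ (2 ^ i)).
Proof.
elim: k z => [|k IHk] z.
  by rewrite big_ord0 big_nat1 /sigma big_ord0 !expr0 mulr1.
rewrite expnS mul2n big_nat_double big_ord_recl expr1.
under [X in _ * X]eq_bigr => i _ do rewrite lift0 expnS exprM.
rewrite -IHk mulr_sumr; apply: eq_bigr => n _.
have := sigma_bit false n; have := sigma_bit true n; rewrite /= add1n => -> ->.
by rewrite add0n add1n exprS [z ^+ _.+1]exprS -mul2n exprM; ring.
Qed.

Section PrimitiveRoot.

Variables (R : fieldType) (p : nat) (z : R).
Hypothesis z_prim : p.-primitive_root z.

(** Cancel [X - 1] in the factorization of [X^p - 1] and evaluate at 1: the quotient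
    [1 + X + ... + X^(p-1)] takes the value [p]. *)
Lemma prod_1_sub_prim_root : \prod_(1 <= i < p) (1 - z ^+ i) = p%:R.
Proof.
have p_gt0 := prim_order_gt0 z_prim.
have := factor_Xn_sub_1 z_prim; rewrite (big_ltn p_gt0) expr0 subrX1.
move/(mulfI (negbT (polyXsubC_eq0 1))) => /(congr1 (horner^~ 1)).
rewrite horner_prod horner_sum.
under eq_bigr do rewrite hornerXsubC.
by under [RHS]eq_bigr do rewrite hornerXn expr1n; rewrite sumr_const card_ord => ->.
Qed.

Lemma sum_prim_root_exp (n : nat) :
  \sum_(0 <= j < p) (z ^+ j) ^+ n = if (p %| n)%N then p%:R else 0.
Proof.
under eq_bigr do rewrite exprAC.
case: ifPn => p_n.
  rewrite (eqP (_ : z ^+ n == 1)) -?(prim_order_dvd z_prim) //.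
  by under eq_bigr do rewrite expr1n; rewrite big_const_nat subn0 iter_addr_0.
(* Multiplying by the nonzero [z ^+ n - 1] telescopes the geometric sum to [z^(np) - 1 = 0]. *)
apply/(mulfI (_ : z ^+ n - 1 != 0)).
  by rewrite subr_eq0 -(prim_order_dvd z_prim).
by rewrite mulr0 big_mkord -subrX1 exprAC (prim_expr_order z_prim) expr1n subrr.
Qed.

Hypothesis p_prime : prime p.
Hypothesis two_primitive : p.-1.-primitive_root (2%:R : 'F_p).

(** By counting: these residues are distinct and nonzero, and there are [p - 1] of them. *)
Lemma perm_two_exp :
  perm_eq [seq (2 ^ k %% p)%N | k <- index_iota 0 p.-1] (index_iota 1 p).
Proof.
have eq_mod a b : ((2%:R : 'F_p) ^+ a == 2%:R ^+ b) = (2 ^ a == 2 ^ b %[mod p])%N.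
  by rewrite -!natrX -val_eqE /= !val_Fp_nat.
have two_neq0 : (2%:R : 'F_p) != 0.
  rewrite (prim_root_eq0 two_primitive); have := prime_gt1 p_prime; lia.
have uniq_pow : uniq [seq (2 ^ k %% p)%N | k <- index_iota 0 p.-1].
  rewrite map_inj_in_uniq ?iota_uniq // => a b.
  rewrite !mem_index_iota /= => lt_a lt_b /eqP.
  by rewrite -eq_mod (eq_prim_root_expr two_primitive) !modn_small // => /eqP.
have sub_pow : {subset [seq (2 ^ k %% p)%N | k <- index_iota 0 p.-1] <= index_iota 1 p}.
  move=> _ /mapP[k _ ->]; rewrite mem_index_iota ltn_mod (prime_gt0 p_prime) andbT lt0n.
  by have := expf_neq0 k two_neq0; rewrite -natrX -val_eqE /= val_Fp_nat.
apply: uniq_perm (iota_uniq _ _) _ => //.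
have [|_ //] := uniq_min_size uniq_pow sub_pow.
by rewrite size_map !size_iota subn0 subn1.
Qed.

Lemma prod_1_sub_two_exp : \prod_(k < p) (1 - z ^+ (2 ^ k)) = p%:R * (1 - z).
Proof.
have p_gt1 := prime_gt1 p_prime.
rewrite -(big_mkord xpredT (fun k => 1 - z ^+ (2 ^ k))).
rewrite -{1}(prednK (prime_gt0 p_prime)) big_nat_recr //=.
congr (_ * _).
  rewrite -prod_1_sub_prim_root -(perm_big _ perm_two_exp) big_map.
  by apply: eq_bigr => k _; rewrite (prim_expr_mod z_prim).
(* The exponents [2^(p-1)] and 1 of [z] are both reduced modulo [p], where they agree. *)
rewrite -(prim_expr_mod z_prim (2 ^ p.-1)) -[in RHS](expr1 z).
rewrite -[in RHS](prim_expr_mod z_prim 1).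
have /(congr1 val) := prim_expr_order two_primitive.
by rewrite -natrX /= val_Fp_nat // Fp_cast // => ->.
Qed.

End PrimitiveRoot.

Theorem theorem1 (p : nat) (p_prime : prime p)
  (two_primitive : p.-1.-primitive_root (2%:R : 'F_p)) :
  Ssum p (2 ^ p)%N = p%:Z.
Proof.
have p_gt0 := prime_gt0 p_prime; have p_gt1 := prime_gt1 p_prime.
have [z z_prim] := C_prim_root_exists p_gt0.
have p_neq0 : p%:R != 0 :> algC by rewrite pnatr_eq0 -lt0n.
apply/(@intr_inj algC)/(mulfI p_neq0).
have -> : p%:R * (Ssum p (2 ^ p))%:~R =
    \sum_(0 <= j < p) \sum_(0 <= n < 2 ^ p) (-1) ^+ sigma n * (z ^+ j) ^+ n.
  rewrite exchange_big /= /Ssum rmorph_sum mulr_sumr big_mkcond /=.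
  apply: eq_bigr => n _; rewrite -mulr_sumr (sum_prim_root_exp z_prim).
  by case: ifP => _; rewrite ?mulr0 // rmorphXn rmorphN1 mulrC.
under eq_bigr do rewrite thue_morse_generating.
have -> : \sum_(0 <= j < p) \prod_(k < p) (1 - (z ^+ j) ^+ (2 ^ k)) =
    \sum_(1 <= j < p) p%:R * (1 - z ^+ j).
  (* For [j = 0] the factor at [k = 0] is already zero. *)
  rewrite big_ltn // (bigD1 (Ordinal p_gt0)) //= !expr1 subrr mul0r add0r.
  apply: eq_big_nat => j /andP[j_gt0 lt_jp].
  apply: prod_1_sub_two_exp => //.
  (* Since [p] is prime, [z ^+ j] is again a primitive root. *)
  by rewrite prim_root_exp_coprime // coprime_sym prime_coprime // gtnNdvd.
(* All [p]-th roots of unity sum to 0, so those other than 1 sum to -1, which leaves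
   [p * ((p - 1) + 1)]. *)
have := sum_prim_root_exp z_prim 1.
rewrite dvdn1 gtn_eqF // big_ltn // expr0 expr1n => /eqP.
rewrite addrC addr_eq0 => /eqP sum_z.
rewrite -mulr_sumr sumrB -[in X in _ - X](eq_bigr _ (fun j _ => expr1 (z ^+ j))) sum_z.
by rewrite opprK big_const_nat iter_addr_0 subn1 natr1 prednK.
Qed.
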